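(* Let $\mathbf A_\star\in\mathbb R^{4\times 2}$ be the matrix with rows $\mathbf a_1=(2,0)$, $\mathbf a_2=(0,1)$, $\mathbf a_3=(1,1)$, $\mathbf a_4=(1,-1)$ (so $n=4$, $d=2$). Let $\mathbf p^{(1)}=(\tfrac14,\tfrac14,\tfrac14,\tfrac14)$ and, for $t\ge1$, $p^{(t+1)}_i=p^{(t)}_i\,v_i(\mathbf p^{(t)})/2$ for $i=1,\dots,4$; let $\bar{\mathbf p}^{(T)}=\frac1T\sum_{t=1}^T\mathbf p^{(t)}$ be the uniform running average. Then $$g(\bar{\mathbf p}^{(T)})=\Theta(1/T)\qquad(T\to\infty).$$ Hence any uniform-averaging certificate uses $\Omega(\varepsilon^{-1})$ leverage-score queries on $\mathbf A_\star$; that is, there are constants $c>0$ and $\varepsilon_0>0$ such that for every $\varepsilon\in(0,\varepsilon_0)$, $g(\bar{\mathbf p}^{(T)})\le\varepsilon d$ implies $T\ge c/\varepsilon$.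
   Context: For $\mathbf p\in\mathbb R^n$ put $\mathbf M(\mathbf p)=\sum_i p_i\mathbf a_i\mathbf a_i^\top$; when $\mathbf M(\mathbf p)\succ0$ the leverage scores are $v_i(\mathbf p)=\mathbf a_i^\top\mathbf M(\mathbf p)^{-1}\mathbf a_i$. The simplex is $\Delta_n=\{\mathbf p\in\mathbb R^n_{\ge0}:\sum_ip_i=1\}$. For $\mathbf p\in\Delta_n$ with $\mathbf M(\mathbf p)\succ0$, the Frank--Wolfe gap is $g(\mathbf p)=\max_{i}v_i(\mathbf p)-d$, and $\mathbf p$ is a $(1+\varepsilon)$-John ellipsoid if $\max_iv_i(\mathbf p)\le(1+\varepsilon)d$, i.e. $g(\mathbf p)\le\varepsilon d$. Since $\sum_ip_iv_i(\mathbf p)=d$ on $\Delta_n$, the iteration stays in $\Delta_4$; it is the Cohen--Cousins--Lee--Yang (CCLY) fixed-point iteration $p_i\propto p_iv_i(\mathbf p)$. A leverage-score query at $\mathbf p$ returns $(v_i(\mathbf p))_i$; each iteration uses one query. A uniform-averaging certificate is a procedure that runs this iteration and certifies the $(1+\varepsilon)$-John guarantee through $g(\bar{\mathbf p}^{(T)})\le\varepsilon d$. The instance $\mathbf A_\star$ has the unique optimal design (minimizer of $-\log\det\mathbf M$ over $\Delta_4$) $\mathbf p^\star=(\tfrac13,0,\tfrac13,\tfrac13)$; it is nondegenerate: $\{i:v_i(\mathbf p^\star)=2\}=\operatorname{supp}\mathbf p^\star=\{1,3,4\}$ and the matrices $\mathbf a_i\mathbf a_i^\top$, $i\in\{1,3,4\}$,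 are linearly independent. Its facial condition number $\kappa$ is $O(1)$, where $\kappa$ is the largest eigenvalue of $\big((\mathbf a_i^\top\mathbf M(\mathbf p^\star)^{-1}\mathbf a_j)^2\big)_{i,j\in\{1,3,4\}}$ divided by its smallest eigenvalue on the sum-zero subspace. *)

(* Defs.v *)
From HB Require Import structures.
From mathcomp Require Import all_boot all_order all_algebra.
From mathcomp Require Import all_classical all_reals all_analysis.
Set Implicit Arguments.
Unset Strict Implicit.
Unset Printing Implicit Defensive.
Import Order.TTheory GRing.Theory Num.Theory.
Import numFieldNormedType.Exports.
Local Open Scope ring_scope.
Local Open Scope classical_set_scope.

Section JohnEllipsoid.
Context {R : realType} {n d : nat}.
(* The rows of A are the vectors a_i^T; n.+1 of them, so that the maximum of
   the leverage scores is taken over a nonempty index set. *)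
Implicit Types (A : 'M[R]_(n.+1, d)) (p : 'rV[R]_n.+1).

Definition simplex : set 'rV[R]_n.+1 :=
  [set p | (forall i, 0 <= p 0 i) /\ \sum_i p 0 i = 1].

Definition posdefmx (M : 'M[R]_d) : Prop :=
  M^T = M /\ forall x : 'cV[R]_d, x != 0 -> 0 < (x^T *m M *m x) 0 0.

Definition info_mx A p : 'M[R]_d :=
  \sum_i p 0 i *: ((row i A)^T *m row i A).

(* invmx is total; the leverage scores, and hence fw_gap, are only meaningful
   where info_mx A p is positive definite. *)
Definition leverage A p (i : 'I_n.+1) : R :=
  (row i A *m invmx (info_mx A p) *m (row i A)^T) 0 0.

Definition admissible A : set 'rV[R]_n.+1 :=
  [set p | simplex p /\ posdefmx (info_mx A p)].

Definition fw_gap A p : R :=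
  \big[Order.max/leverage A p ord0]_i leverage A p i - d%:R.

Definition ccly_step A p : 'rV[R]_n.+1 :=
  \row_i (p 0 i * leverage A p i / d%:R).

(* Iterates are numbered from 1, as p^(1), p^(2), ...; index 0 is unused. *)
Definition ccly A p t : 'rV[R]_n.+1 := iter t.-1 (ccly_step A) p.

Definition ccly_avg A p T : 'rV[R]_n.+1 :=
  T%:R^-1 *: \sum_(1 <= t < T.+1) ccly A p t.

End JohnEllipsoid.

Definition Astar (R : realType) : 'M[R]_(4, 2) :=
  \matrix_(i, j)
    nth 0 (nth [::] [:: [:: 2; 0]; [:: 0; 1]; [:: 1; 1]; [:: 1; -1]] i) j.

Definition p1 (R : realType) : 'rV[R]_4 := const_mx (4^-1).

(* Main.v *)
(* Under the symmetry p_3 = p_4 the information matrix is diag(X, Y) with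
   X = 4 p_1 + 2 p_3 and Y = p_2 + 2 p_3.

   Lower bound: p* = (1/3, 0, 1/3, 1/3) averages the leverage scores of p to
   2/X + 2/(3Y), where X + 3Y = 4 - p_2, so g(p) >= p_2 / 2; and the average
   of the iterates keeps p_2 >= 1/(4T) from its first term.

   Upper bound: 1 / v_i is concave in p, while
   1 / v_i(p^(t)) = p_i^(t) / (2 p_i^(t+1)) >=
   (1 + ln p_i^(t) - ln p_i^(t+1)) / 2,
   which telescopes over t: v_i at the average is at most 2T / (T - ln 4). *)
Require Import Defs.
From HB Require Import structures.
From mathcomp Require Import all_boot all_order all_algebra.
From mathcomp Require Import all_classical all_reals all_analysis.
From mathcomp Require Import ring lra.
Set Implicit Arguments.
Unset Strict Implicit.
Unset Printing Implicit Defensive.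
Import Order.TTheory GRing.Theory Num.Theory.
Import numFieldNormedType.Exports.
Local Open Scope ring_scope.
Local Open Scope classical_set_scope.

(** * Diagonal information matrices and sums over four indices *)

Lemma info_mxE (R : realType) n d (A : 'M[R]_(n.+1, d)) p j k :
  info_mx A p j k = \sum_i p 0 i * (A i j * A i k).
Proof.
rewrite summxE; apply: eq_bigr => i _.
by rewrite !mxE big_ord1 !mxE.
Qed.

Lemma invmx_diag (F : fieldType) n (D : 'rV[F]_n) :
  (forall j, D 0 j != 0) -> invmx (diag_mx D) = diag_mx (\row_j (D 0 j)^-1).
Proof.
move=> D0.
have DV : diag_mx D *m diag_mx (\row_j (D 0 j)^-1) = 1%:M.
  rewrite mulmx_diag -diag_const_mx; congr diag_mx.
  by apply/rowP => j; rewrite !mxE divff.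
have [uD _] := mulmx1_unit DV.
by rewrite -[RHS](mulKmx uD) DV mulmx1.
Qed.

Lemma posdefmx_diag (R : realType) d (D : 'rV[R]_d) :
  (forall j, 0 < D 0 j) -> posdefmx (diag_mx D).
Proof.
move=> D0; split=> [|x xn0]; first by rewrite tr_diag_mx.
have E : (x^T *m diag_mx D *m x) 0 0 = \sum_j D 0 j * x j 0 ^+ 2.
  rewrite mul_mx_diag mxE; apply: eq_bigr => j _; rewrite !mxE; ring.
have ge0 j : 0 <= D 0 j * x j 0 ^+ 2 by rewrite mulr_ge0 ?sqr_ge0 ?ltW.
rewrite E lt_neqAle sumr_ge0 // andbT eq_sym; apply: contra xn0 => /eqP.
move=> /(psumr_eq0P (fun j _ => ge0 j)) s0.
apply/eqP/colP => j; have /eqP := s0 j isT.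
by rewrite mulf_eq0 gt_eqF //= sqrf_eq0 !mxE => /eqP.
Qed.

Lemma leverage_diag (R : realType) n d (A : 'M[R]_(n.+1, d)) p (D : 'rV[R]_d) i :
  (forall j, D 0 j != 0) -> info_mx A p = diag_mx D ->
  leverage A p i = \sum_j A i j ^+ 2 / D 0 j.
Proof.
move=> D0 ApD; rewrite /leverage ApD invmx_diag // mul_mx_diag mxE.
by apply: eq_bigr => j _; rewrite !mxE; ring.
Qed.

Lemma sum4 (V : nmodType) (F : 'I_4 -> V) :
  \sum_i F i = F (inord 0) + F (inord 1) + F (inord 2) + F (inord 3).
Proof.
rewrite !big_ord_recl big_ord0 addr0 !addrA.
by do !congr (_ + _); congr F; apply/val_inj; rewrite /= inordK.
Qed.

Lemma ord4_ind (P : 'I_4 -> Prop) :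
  P (inord 0) -> P (inord 1) -> P (inord 2) -> P (inord 3) -> forall i, P i.
Proof.
move=> P0 P1 P2 P3 i; rewrite -(inord_val i).
by case: i => -[|[|[|[|m]]]].
Qed.

(** * The instance and its symmetric designs *)

Section Astar.
Context {R : realType}.
Implicit Types (p : 'rV[R]_4) (i : 'I_4) (t T : nat).

Lemma Astar0 : [/\ Astar R (inord 0) 0 = 2, Astar R (inord 1) 0 = 0,
  Astar R (inord 2) 0 = 1 & Astar R (inord 3) 0 = 1].
Proof. by split; rewrite mxE /= inordK. Qed.

Lemma Astar1 : [/\ Astar R (inord 0) 1 = 0, Astar R (inord 1) 1 = 1,
  Astar R (inord 2) 1 = 1 & Astar R (inord 3) 1 = -1].
Proof. by split; rewrite mxE /= inordK. Qed.

(* Indices start at 0: the paper's p_1, p_2, p_3, p_4 are p 0 (inord 0), ...,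
   p 0 (inord 3). *)
Definition diag0 p : R := 4 * p 0 (inord 0) + p 0 (inord 2) + p 0 (inord 3).
Definition diag1 p : R := p 0 (inord 1) + p 0 (inord 2) + p 0 (inord 3).

(** The equality cancels p_3 - p_4, the off-diagonal entry of the information matrix. Strict
    positivity makes the diagonal positive and allows logarithms of the iterates. *)
Definition symmetric_design p : Prop :=
  [/\ forall i, 0 < p 0 i, \sum_i p 0 i = 1 & p 0 (inord 2) = p 0 (inord 3)].

Lemma symmetric_design_diag_gt0 p :
  symmetric_design p -> 0 < diag0 p /\ 0 < diag1 p.
Proof.
case=> p0 _ _; have := (p0 (inord 0), p0 (inord 1), p0 (inord 2), p0 (inord 3)).
by rewrite /diag0 /diag1 => -[[[]]] *; split; lra.
Qed.

Lemma info_mx_Astar p : symmetric_design p ->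
  info_mx (Astar R) p = diag_mx (\row_j (if j == 0 then diag0 p else diag1 p)).
Proof.
case=> _ _ p23; apply/matrixP => j k; rewrite info_mxE sum4 ![in RHS]mxE.
have [[A00 A10 A20 A30] [A01 A11 A21 A31]] := (Astar0, Astar1).
have ord2 (l : 'I_2) : l = 0 \/ l = 1.
  by case: l => -[|[|//]] ?; [left|right]; exact: val_inj.
have [->|->] := ord2 j; have [->|->] := ord2 k;
  rewrite ?(A00, A10, A20, A30, A01, A11, A21, A31) /= /diag0 /diag1 p23; ring.
Qed.

Lemma symmetric_design_admissible p :
  symmetric_design p -> admissible (Astar R) p.
Proof.
move=> sp; have [D0 D1] := symmetric_design_diag_gt0 sp.
split; first by case: sp => p0 p1 _; split => // i; exact: ltW.
rewrite info_mx_Astar //; apply: posdefmx_diag => j.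
by rewrite mxE; case: ifP.
Qed.

Lemma leverage_Astar p i : symmetric_design p ->
  leverage (Astar R) p i =
  Astar R i 0 ^+ 2 / diag0 p + Astar R i 1 ^+ 2 / diag1 p.
Proof.
move=> sp; have [D0 D1] := symmetric_design_diag_gt0 sp.
rewrite (leverage_diag _ _ (info_mx_Astar sp)) => [|j].
  by rewrite big_ord_recl big_ord1 !mxE.
by rewrite mxE; case: ifP => _; rewrite gt_eqF.
Qed.

Lemma leverage_Astar_gt0 p i : symmetric_design p -> 0 < leverage (Astar R) p i.
Proof.
move=> sp; have [D0 D1] := symmetric_design_diag_gt0 sp.
have [[A00 A10 A20 A30] [A01 A11 A21 A31]] := (Astar0, Astar1).
(* Positivity is stated for the inverses, in which the leverage scores are linear. *)
rewrite leverage_Astar //; move: D0 D1; rewrite -!(invr_gt0 (diag0 _)) -!(invr_gt0 (diag1 _)).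
elim/ord4_ind: i; rewrite ?(A00, A10, A20, A30, A01, A11, A21, A31) => *; lra.
Qed.

(** The sum stays 1 because sum_i p_i v_i is the trace of the identity, here 2. Rows 3 and 4 differ
    in the sign of one entry, which squaring removes, so p_3 and p_4 are scaled alike. *)
Lemma symmetric_design_step p :
  symmetric_design p -> symmetric_design (ccly_step (Astar R) p).
Proof.
move=> sp; have [D0 D1] := symmetric_design_diag_gt0 sp.
have [[A00 A10 A20 A30] [A01 A11 A21 A31]] := (Astar0, Astar1).
case: (sp) => p0 p1 p23; split => [i||].
- by rewrite mxE divr_gt0 ?mulr_gt0 ?leverage_Astar_gt0.
- under eq_bigr do rewrite mxE leverage_Astar //.
  rewrite sum4 A00 A10 A20 A30 A01 A11 A21 A31.
  rewrite /diag0 /diag1 in D0 D1 *; field.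
  by rewrite !gt_eqF.
- by rewrite !mxE !leverage_Astar // p23 A20 A30 A21 A31; ring.
Qed.

(** * Iterates and their running averages *)

Lemma symmetric_design_ccly t : symmetric_design (ccly (Astar R) (p1 R) t).
Proof.
rewrite /ccly; elim: t.-1 => [|m IH]; last exact: symmetric_design_step.
split => [i||]; rewrite ?mxE ?invr_gt0 //.
by rewrite sum4 !mxE; field.
Qed.

Lemma ccly_avgE T i : ccly_avg (Astar R) (p1 R) T 0 i =
  T%:R^-1 * \sum_(1 <= t < T.+1) ccly (Astar R) (p1 R) t 0 i.
Proof. by rewrite mxE summxE. Qed.

Lemma symmetric_design_avg T : (0 < T)%N ->
  symmetric_design (ccly_avg (Astar R) (p1 R) T).
Proof.
move=> T0; have Tr : (0 : R) < T%:R by rewrite ltr0n.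
split => [i||].
(* The first iterate alone gives strict positivity. *)
- rewrite ccly_avgE mulr_gt0 ?invr_gt0 // big_nat_recl //.
  rewrite ltr_wpDr //; last by case: (symmetric_design_ccly 1).
  by apply: sumr_ge0 => t _; case: (symmetric_design_ccly t.+1) => /(_ i)/ltW.
- under eq_bigr do rewrite ccly_avgE.
  rewrite -mulr_sumr exchange_big /=.
  rewrite (eq_bigr (fun=> 1)) => [|t _]; last by case: (symmetric_design_ccly t).
  by rewrite big_const_nat iter_addr_0 subn1 /= mulVf ?gt_eqF.
- rewrite !ccly_avgE; congr (_ * _); apply: eq_bigr => t _.
  by case: (symmetric_design_ccly t).
Qed.

(** * Lower bound on the gap by the second coordinate *)

Lemma fw_gap_ge p : symmetric_design p ->
  p 0 (inord 1) / 2 <= fw_gap (Astar R) p.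
Proof.
move=> sp; have [D0 D1] := symmetric_design_diag_gt0 sp.
have lev i : leverage (Astar R) p i <= fw_gap (Astar R) p + 2.
  by rewrite subrK; exact: le_bigmax.
have := (lev (inord 0), lev (inord 2)).
have [[A00 A10 A20 A30] [A01 A11 A21 A31]] := (Astar0, Astar1).
rewrite !leverage_Astar // A00 A20 A01 A21.
case: sp => p0 /eqP; rewrite sum4 => /eqP p1 p23.
set b := p 0 (inord 1) in p1 *.
have b0 : 0 < b := p0 _.
set g := fw_gap _ _; set X := diag0 p in D0 *; set Y := diag1 p in D1 *.
have XY : X + 3 * Y = 4 - b by rewrite /X /Y /diag0 /diag1 -/b; lra.
move=> [l0 l2].
(* A third of [l0] plus two thirds of [l2], the latter standing for both p_3 and p_4. *)
have l : 2 / X + 2 / (3 * Y) <= g + 2.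
  have -> : 2 / (3 * Y) = 2 / 3 * Y^-1 :> R by field; rewrite gt_eqF.
  lra.
have b4 : 0 < 4 - b by rewrite -XY; lra.
(* The harmonic mean of X and 3Y is at most their arithmetic mean. *)
have l' : 8 / (4 - b) <= 2 / X + 2 / (3 * Y).
  rewrite -XY -subr_ge0.
  have -> : 2 / X + 2 / (3 * Y) - 8 / (X + 3 * Y) =
      2 * (X - 3 * Y) ^+ 2 / (X * (3 * Y) * (X + 3 * Y)).
    by field; rewrite !gt_eqF // XY.
  by rewrite XY divr_ge0 // mulr_ge0 ?sqr_ge0 // ltW // !mulr_gt0.
(* The linear terms cancel: (b/2 + 2)(4 - b) = 8 - b^2/2. *)
have : b / 2 + 2 <= 8 / (4 - b) by rewrite ler_pdivlMr //; nra.
lra.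
Qed.

(** * Upper bound on the leverage scores of the average *)

Lemma ccly_recr t i : (0 < t)%N -> ccly (Astar R) (p1 R) t.+1 0 i =
  ccly (Astar R) (p1 R) t 0 i * leverage (Astar R) (ccly (Astar R) (p1 R) t) i / 2.
(* The numbers 0 and 1 denote the same iterate, so the recursion starts at t = 1. *)
Proof. by case: t => // t _; rewrite {1}/ccly /= mxE. Qed.

(** Cauchy-Schwarz for (sqrt(a/x), sqrt(b/y)) and (sqrt(a x)/u, sqrt(b y)/v). Below, x, y are the
    diagonal entries for an iterate and u, v those for the average. *)
Lemma weighted_harmonic_cauchy (a b x y u v : R) :
  0 <= a -> 0 <= b -> 0 < x -> 0 < y -> 0 < u -> 0 < v ->
  (a / u + b / v) ^+ 2 <= (a / x + b / y) * (a * x / u ^+ 2 + b * y / v ^+ 2).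
Proof.
move=> a0 b0 x0 y0 u0 v0; rewrite -subr_ge0.
have -> : (a / x + b / y) * (a * x / u ^+ 2 + b * y / v ^+ 2)
    - (a / u + b / v) ^+ 2
  = a * b * (x * v - y * u) ^+ 2 / (x * y * u ^+ 2 * v ^+ 2).
  by field; rewrite !gt_eqF.
apply: divr_ge0; last by rewrite ltW // !mulr_gt0 ?exprn_gt0.
by rewrite mulr_ge0 ?sqr_ge0 // mulr_ge0.
Qed.

(* Concavity of M |-> 1 / (a^T M^-1 a). *)
Lemma leverage_avg_harmonic T i : (0 < T)%N ->
  leverage (Astar R) (ccly_avg (Astar R) (p1 R) T) i *
    \sum_(1 <= t < T.+1) (leverage (Astar R) (ccly (Astar R) (p1 R) t) i)^-1
  <= T%:R.
Proof.
move=> T0; have Tr : (0 : R) < T%:R by rewrite ltr0n.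
have sT := symmetric_design_avg T0; have vT := leverage_Astar_gt0 i sT.
have [X0 Y0] := symmetric_design_diag_gt0 sT.
rewrite -(ler_pM2l vT) mulrA -expr2 mulr_sumr.
set q := ccly_avg _ _ _ in sT vT X0 Y0 *.
pose a := Astar R i 0 ^+ 2; pose b := Astar R i 1 ^+ 2.
(* The right side is linear in the iterate and equals the left side when the iterate is [q]; summed
   over t, it becomes T times its value at [q]. *)
have le_t t : leverage (Astar R) q i ^+ 2 / leverage (Astar R) (ccly (Astar R) (p1 R) t) i
    <= a / diag0 q ^+ 2 * diag0 (ccly (Astar R) (p1 R) t)
     + b / diag1 q ^+ 2 * diag1 (ccly (Astar R) (p1 R) t).
  have st := symmetric_design_ccly t; have [Xt Yt] := symmetric_design_diag_gt0 st.
  rewrite ler_pdivrMr ?leverage_Astar_gt0 // !leverage_Astar // [leRHS]mulrC.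
  rewrite ![_ / _ ^+ 2 * _]mulrAC.
  by apply: weighted_harmonic_cauchy; rewrite ?sqr_ge0.
apply: le_trans (ler_sum _ (fun t _ => le_t t)) _.
have avg0 : \sum_(1 <= t < T.+1) diag0 (ccly (Astar R) (p1 R) t) = T%:R * diag0 q.
  by rewrite /diag0 !big_split /= -mulr_sumr !ccly_avgE; field; rewrite gt_eqF.
have avg1 : \sum_(1 <= t < T.+1) diag1 (ccly (Astar R) (p1 R) t) = T%:R * diag1 q.
  by rewrite /diag1 !big_split /= !ccly_avgE; field; rewrite gt_eqF.
rewrite big_split /= -!mulr_sumr avg0 avg1 leverage_Astar // le_eqVlt.
by apply/orP; left; apply/eqP; rewrite -/a -/b; field; rewrite !gt_eqF.
Qed.

Lemma sum_inv_leverage_ge T i : (0 < T)%N ->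
  (T%:R - 3) / 2 <=
  \sum_(1 <= t < T.+1) (leverage (Astar R) (ccly (Astar R) (p1 R) t) i)^-1.
Proof.
move=> T0; pose f t : R := ln (ccly (Astar R) (p1 R) t 0 i).
have pos t : 0 < ccly (Astar R) (p1 R) t 0 i by case: (symmetric_design_ccly t).
have le_t t : (1 <= t < T.+1)%N -> 1 / 2 - (f t.+1 - f t) / 2 <=
    (leverage (Astar R) (ccly (Astar R) (p1 R) t) i)^-1.
  case/andP=> t0 _; have := leverage_Astar_gt0 i (symmetric_design_ccly t).
  set v := leverage _ _ _ => v0.
  have -> : f t.+1 = f t + ln (v / 2).
    by rewrite /f ccly_recr // -mulrA lnM // posrE ?pos ?divr_gt0.
  (* This is ln x <= x - 1 at x = 2/v; ln (v/2) is the increment of [f]. *)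
  have : ln (1 + (2 / v - 1)) <= 2 / v - 1.
    by apply: le_ln1Dx; rewrite ltrBrDr addNr divr_gt0.
  have -> : 1 + (2 / v - 1) = (v / 2)^-1 by rewrite invf_div; ring.
  rewrite lnV ?posrE ?divr_gt0 //; lra.
rewrite (le_trans _ (ler_sum_nat le_t)) // sumrB big_const_nat iter_addr_0 subn1 /=.
rewrite -mulr_suml telescope_sumr // -mulr_natl.
(* The entries of [p1] are 1/4, and 3 is a crude rational bound for ln 4. *)
have f1 : - 3 <= f 1.
  rewrite /f /ccly /= mxE lnV ?posrE // lerN2.
  have -> : 4 = 1 + 3 :> R by ring.
  by apply: le_ln1Dx; lra.
have fT : f T.+1 <= 0.
  apply: ln_le0; have [p0 <- _] := symmetric_design_ccly T.+1.
  by rewrite (bigD1 i) //= lerDl sumr_ge0 // => j _; exact: ltW.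
lra.
Qed.

(** * Two-sided bounds of order 1/T *)

Lemma fw_gap_avg_le T : (6 <= T)%N ->
  fw_gap (Astar R) (ccly_avg (Astar R) (p1 R) T) <= 12 / T%:R.
Proof.
move=> T6; have T0 : (0 < T)%N by exact: leq_trans T6.
have Tr : (6 : R) <= T%:R by rewrite ler_nat.
have lev i : leverage (Astar R) (ccly_avg (Astar R) (p1 R) T) i <= 12 / T%:R + 2.
  have := leverage_avg_harmonic i T0; have := sum_inv_leverage_ge i T0.
  have := leverage_Astar_gt0 i (symmetric_design_avg T0).
  set v := leverage _ _ _; set s := \sum_(_ <= t < _) _ => v0 sT vs.
  (* Hence v - 2 <= 6/(T - 3), which is at most 12/T once T >= 6. *)
  have vT : v * (T%:R - 3) <= 2 * T%:R by nra.
  rewrite -(ler_pM2r (_ : 0 < T%:R - 3)); last lra.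
  apply: le_trans vT _.
  have -> : (12 / T%:R + 2) * (T%:R - 3) = 2 * T%:R + 6 - 36 / T%:R :> R.
    by field; rewrite gt_eqF //; lra.
  by rewrite -addrA lerDl subr_ge0 ler_pdivrMr; lra.
by rewrite lerBlDr; apply: bigmax_le.
Qed.

(** The factor 1/8 is the 1/2 of [fw_gap_ge] times the entry 1/4 of [p1]; later iterates only add
    nonnegative terms. *)
Lemma fw_gap_avg_ge T : (0 < T)%N ->
  8^-1 / T%:R <= fw_gap (Astar R) (ccly_avg (Astar R) (p1 R) T).
Proof.
move=> T0; apply: le_trans (fw_gap_ge (symmetric_design_avg T0)).
have -> : 8^-1 / T%:R = T%:R^-1 * 4^-1 / 2 :> R by field; rewrite pnatr_eq0 -lt0n.
rewrite ler_pM2r ?invr_gt0 // ccly_avgE ler_pM2l ?invr_gt0 ?ltr0n //.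
rewrite big_nat_recl // {1}/ccly /= mxE lerDl.
by apply: sumr_ge0 => t _; case: (symmetric_design_ccly t.+1) => /(_ (inord 1))/ltW.
Qed.

End Astar.

Theorem theorem3p4 (R : realType) :
  [/\ (* every quantity below is well defined *)
      forall t : nat, (0 < t)%N ->
        admissible (Astar R) (ccly (Astar R) (p1 R) t) /\
        admissible (Astar R) (ccly_avg (Astar R) (p1 R) t),
      (fun T : nat => fw_gap (Astar R) (ccly_avg (Astar R) (p1 R) T))
        \is 'Theta_\oo (fun T : nat => T%:R^-1 : R) &
      exists c eps0 : R, [/\ 0 < c, 0 < eps0 &
        forall eps : R, 0 < eps < eps0 ->
        forall T : nat, (0 < T)%N ->
          fw_gap (Astar R) (ccly_avg (Astar R) (p1 R) T) <= eps * 2 ->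
          c / eps <= T%:R]].
Proof.
split.
- move=> t t0; split; apply: symmetric_design_admissible.
    exact: symmetric_design_ccly.
  exact: symmetric_design_avg.
- rewrite qualifE; apply/asboolP; exists (8^-1, 12) => /=.
    by rewrite invr_gt0 !ltr0n.
  near=> T; have T6 : (6 <= T)%N by near: T; exists 6%N.
  have T0 : (0 < T)%N by exact: leq_trans T6.
  have lb := fw_gap_avg_ge (R := R) T0.
  rewrite (ger0_norm (le_trans _ lb)) ?ger0_norm ?mulr_ge0 ?invr_ge0 //.
  by split=> //; exact: fw_gap_avg_le.
(* From 1/(8T) <= 2 eps follows T >= 1/(16 eps), whence c = 1/16. *)
- exists 16^-1, 1; split=> // eps /andP[eps0 _] T T0 gT.
  have Tr : (0 : R) < T%:R by rewrite ltr0n.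
  have := le_trans (fw_gap_avg_ge (R := R) T0) gT.
  rewrite !ler_pdivrMr //; nra.
Unshelve. all: by end_near.
Qed.
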